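(* Let $K$ be a field, let $n\geq 1$, let $A_1,\ldots,A_n$ be non-empty finite subsets of $K$, let $d_i=|A_i|$, and let $X^*=A_1\times\cdots\times A_n\subset K^n$. Let $d\geq 1$ be an integer. If $d_i\leq d_{i+1}$ for all $i$ and $d=\sum_{i=1}^k(d_i-1)+\ell$ for some integers $k,\ell$ such that $1\leq\ell\leq d_{k+1}-1$ and $0\leq k\leq n-1$, then $$ \max\{|Z_{X^*}(F)| : F\in S_{\leq d},\ F\not\equiv 0\}\leq d_{k+2}\cdots d_n\,(d_1\cdots d_{k+1}-d_{k+1}+\ell). $$
   Context: $S_{\leq d}$ is the $K$-vector space of polynomials of $K[t_1,\ldots,t_n]$ of total degree at most $d$. $Z_{X^*}(F)=\{P\in X^* : F(P)=0\}$ is the zero set of $F$ in $X^*$. $F\not\equiv 0$ means that $F$ is not the zero function on $X^*$. The product $d_{k+2}\cdots d_n$ is $1$ if $k=n-1$. *)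

(* Defs.v *)
From mathcomp Require Import all_boot all_order all_algebra.
From mathcomp Require Import finmap mpoly.

Set Implicit Arguments.
Unset Strict Implicit.
Unset Printing Implicit Defensive.

Local Open Scope ring_scope.
Local Open Scope fset_scope.

(* Coordinates are indexed from 0: the sets A_1, ..., A_n are the values of
   A : 'I_n -> {fset K} at 0, ..., n - 1, and a point of K^n is a finite
   function on 'I_n. *)

Definition cartesian (K : choiceType) (n : nat) (A : 'I_n -> {fset K}) :
    {fset {ffun 'I_n -> K}} :=
  [fset [ffun i => fsval (x i)] |
    x : {dffun forall i : 'I_n, A i} in {: {dffun forall i : 'I_n, A i}}].

Lemma in_cartesian (K : choiceType) (n : nat) (A : 'I_n -> {fset K})
    (P : {ffun 'I_n -> K}) :
  (P \in cartesian A) = [forall i, P i \in A i].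
Proof.
apply/imfsetP/forallP => /= [[x _ ->] i | PA]; first by rewrite ffunE fsvalP.
exists [ffun i => [` PA i]] => //.
by apply/ffunP => i; rewrite !ffunE.
Qed.

(* [msize F] is 1 plus the total degree of F, and 0 when F = 0. *)
Definition deg_le (K : fieldType) (n d : nat) (F : {mpoly K[n]}) : bool :=
  (msize F <= d.+1)%N.

Definition zero_set (K : fieldType) (n : nat) (X : {fset {ffun 'I_n -> K}})
    (F : {mpoly K[n]}) : {fset {ffun 'I_n -> K}} :=
  [fset P in X | F.@[P] == 0].

Definition not_identically_zero (K : fieldType) (n : nat)
    (X : {fset {ffun 'I_n -> K}}) (F : {mpoly K[n]}) : Prop :=
  exists2 P, P \in X & F.@[P] != 0.

Definition is_max (S : nat -> Prop) (m : nat) : Prop :=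
  S m /\ forall j, S j -> (j <= m)%N.

Definition zero_count (K : fieldType) (n : nat) (X : {fset {ffun 'I_n -> K}})
    (d j : nat) : Prop :=
  exists F : {mpoly K[n]},
    [/\ deg_le d F, not_identically_zero X F & #|` zero_set X F| = j].

(* Main.v *)
(** A polynomial F of degree at most D that is nonzero somewhere on the grid
    has at least [greedy [:: d_1; ...; d_n] D] nonzeros there if
    d_1 <= ... <= d_n, by induction on the number of free coordinates.
    Let B be the set of values a in A_1 such that F vanishes on the slice
    x_1 = a.  On the grid, F is the product of the x_1 - a, for a in B, and of
    a polynomial G of degree at most D - |B|, and each of the other
    d_1 - |B| slices has as many nonzeros for G as for F.  The induction
    closes because spending the degree on the smallest sets first minimizes
    the product of the d_i - r_i. *)

Require Import Defs.
From mathcomp Require Import all_boot all_order all_algebra.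
From mathcomp Require Import finmap mpoly.
From mathcomp Require Import zify ring.
From Stdlib Require Import Classical_Prop.

Set Implicit Arguments.
Unset Strict Implicit.
Unset Printing Implicit Defensive.

Import GRing.Theory.

(** * Arithmetic of distributing the degree *)

Local Open Scope nat_scope.

(* For sorted [ds] with positive entries, the minimum of the products of the
   d_i - r_i subject to r_i < d_i and r_1 + ... + r_n <= D. *)
Fixpoint greedy (ds : seq nat) (D : nat) : nat :=
  if ds is d :: ds' then
    if D < d then (d - D) * \prod_(e <- ds') e else greedy ds' (D - d.-1)
  else 1.

(** A unit of degree takes a larger proportion of a small factor than of a large one, so moving
    [v - 1] units from a factor [v] to entries at least [v] cannot lower the product. *)
Lemma greedy_transfer (v : nat) (ds : seq nat) (D : nat) :
  0 < v -> path leq v ds -> greedy ds (D - v.-1) <= v * greedy ds D.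
Proof.
move=> v_gt0; elim: ds D => [|d ds IH] D /=; first by lia.
case/andP=> le_vd ds_path.
have {}IH := IH _ (path_le leq_trans le_vd ds_path).
have [ltDd | leDd] := ltnP D d.
  rewrite (_ : D - v.-1 < d) ?mulnA ?leq_mul2r; last by lia.
  apply/orP; right; case: (leqP v.-1 D) => ?; first by nia.
  rewrite (_ : D - v.-1 = 0); first by nia.
  lia.
have [ltDvd | leDvd] := ltnP (D - v.-1) d; last first.
  by rewrite -subnDA addnC subnDA IH.
(* Put [t = D - (d - 1)], so [0 < t < v]. The left side stops at [d] with factor [v - t], the right
   one at the next entry [e] with factor [e - t], and [(v - t) * e <= v * (e - t)] because
   [v <= e]. *)
case: ds ds_path {IH} => [_ | e ds /= /andP[le_de _]].
  by rewrite big_nil /=; lia.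
rewrite (_ : D - d.-1 < e); last by lia.
by rewrite big_cons !mulnA leq_mul2r; apply/orP; right; nia.
Qed.

Lemma greedy_cons (d r : nat) (ds : seq nat) (D : nat) :
  path leq d ds -> r < d -> r <= D ->
  greedy (d :: ds) D <= (d - r) * greedy ds (D - r).
Proof.
move=> ds_path ltrd lerD /=; have [ltDd | leDd] := ltnP D d; last first.
  (* Once [r] units are spent, cutting [d] down to 1 is the exchange with [v = d - r]. *)
  rewrite (_ : D - d.-1 = D - r - (d - r).-1); last by lia.
  apply: greedy_transfer; first by lia.
  by apply: (path_le leq_trans) ds_path; lia.
case: ds ds_path => [_ | e ds /= /andP[le_de _]].
  by rewrite big_nil /=; lia.
rewrite (_ : D - r < e); last by lia.
by rewrite big_cons !mulnA leq_mul2r; apply/orP; right; nia.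
Qed.

Lemma greedy_cat (ds es : seq nat) (d l : nat) :
  all (leq 1) ds -> 0 < l < d ->
  greedy (ds ++ d :: es) (\sum_(e <- ds) (e - 1) + l) =
    (d - l) * \prod_(e <- es) e.
Proof.
move=> + /andP[l_gt0 lt_ld]; elim: ds => [|e ds IH] /=.
  by rewrite big_nil add0n lt_ld.
(* Since [l >= 1], the budget reaches [e], which is cut down to factor 1 at cost [e - 1]. *)
case/andP=> e_gt0 /IH <-; rewrite big_cons (_ : _ < e = false); last by lia.
by congr greedy; lia.
Qed.

Lemma sum_count_le (T : Type) (I : eqType) (f : T -> I) (c : pred T)
    (s : seq T) (B : seq I) :
  uniq B -> \sum_(b <- B) count (fun x => c x && (f x == b)) s <= count c s.
Proof.
move=> B_uniq; elim: s => [|x s IH] /=; first by rewrite big1.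
rewrite big_split leq_add //; case: (c x) => /=; last by rewrite big1.
rewrite -big_mkcond sum1_count (eq_count (a2 := pred1 (f x))).
  by rewrite count_uniq_mem // leq_b1.
by move=> b; rewrite /= eq_sym.
Qed.

(** * Division by linear factors in one coordinate *)

Local Open Scope ring_scope.

Definition update (K : choiceType) (n : nat) (v : 'I_n -> K) (i : 'I_n)
    (a : K) : {ffun 'I_n -> K} :=
  [ffun j => if j == i then a else v j].

(** The identity is linear in [F], so monomials suffice; for these, induct on the exponent of the
    coordinate [i]. *)
Lemma mpoly_div_coord (K : fieldType) (n : nat) (i : 'I_n) (a : K)
    (F : {mpoly K[n]}) :
  exists2 G : {mpoly K[n]}, (msize G <= (msize F).-1)%N &
    forall v, F.@[v] = (v i - a) * G.@[v] + F.@[update v i a].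
Proof.
pose P d (H : {mpoly K[n]}) := exists2 G : {mpoly K[n]}, (msize G <= d)%N &
  forall v, H.@[v] = (v i - a) * G.@[v] + H.@[update v i a].
have PX m : P (mdeg m) 'X_[m].
  elim: {m}(m i) {-2}m (erefl (m i)) => [|e IH] m mi.
    exists 0 => [|v]; first by rewrite msize0.
    rewrite meval0 mulr0 add0r !mevalX; apply: eq_bigr => j _.
    by rewrite ffunE; case: eqP => // ->; rewrite mi !expr0.
  have le_im : (U_(i) <= m)%MM by rewrite lep1mP mi.
  have <- := submK le_im; rewrite mpolyXD mdegD mdeg1 addn1.
  case: (IH (m - U_(i))%MM) => [|G sG evG].
    by rewrite mnmBE mnm1E eqxx mi subn1.
  (* If [M = (x_i - a) * G + M(a)], then [x_i * M = (x_i - a) * (M + a * G) + a * M(a)]. *)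
  exists ('X_[m - U_(i)] + a *: G) => [|v].
    apply: leq_trans (msizeD_le _ _) _; rewrite geq_max msizeX leqnn /=.
    by apply: leq_trans (msizeZ_le _ _) _; apply: leqW.
  rewrite !mevalM !mevalD mevalZ !mevalXU evG ffunE eqxx; ring.
(* Only the evaluated [F] is expanded; the bound [(msize F).-1] stays fixed, common to all
   summands. *)
rewrite [X in exists2 G, _ & forall v, X.@[_] = _ + X.@[_]]mpolyE.
rewrite -/(P (msize F).-1 _) big_seq; elim/big_ind: _.
- by exists 0 => [|v]; rewrite ?msize0 // !meval0 mulr0 addr0.
- move=> H1 H2 [G1 s1 ev1] [G2 s2 ev2]; exists (G1 + G2) => [|v].
    by apply: leq_trans (msizeD_le _ _) _; rewrite geq_max s1.
  by rewrite !mevalD ev1 ev2; ring.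
move=> m /msize_mdeg_lt ltm; have [G sG evG] := PX m.
exists (F@_m *: G) => [|v]; last by rewrite !mevalZ evG; ring.
by apply: leq_trans (msizeZ_le _ _) _; lia.
Qed.

(** Divide by one factor at a time. Closure of [S] under updates makes the remainder vanish on [S];
    the quotient still vanishes where [v i] is another element of [B], as [v i - a] is nonzero
    there. *)
Lemma mpoly_div_roots (K : fieldType) (n : nat) (i : 'I_n)
    (S : {ffun 'I_n -> K} -> Prop) (B : seq K) (F : {mpoly K[n]}) :
    uniq B -> (forall v a, S v -> a \in B -> S (update v i a)) ->
    (forall v, S v -> v i \in B -> F.@[v] = 0) ->
  exists2 G : {mpoly K[n]}, (msize G <= msize F - size B)%N &
    forall v, S v -> F.@[v] = \prod_(a <- B) (v i - a) * G.@[v].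
Proof.
elim: B F => [|a B IH] F /=.
  by exists F => [|v _]; rewrite ?subn0 // big_nil mul1r.
case/andP=> aNB B_uniq S_upd F0.
have [G1 sG1 evG1] := mpoly_div_coord i a F.
have {}evG1 v : S v -> F.@[v] = (v i - a) * G1.@[v].
  move=> Sv; rewrite evG1 [X in _ + X]F0 ?addr0 //.
    by apply: S_upd; rewrite ?mem_head.
  by rewrite ffunE eqxx mem_head.
have [||G sG evG] := IH G1 B_uniq.
- by move=> v b Sv bB; apply: S_upd; rewrite // inE bB orbT.
- move=> v Sv vB; have := F0 v Sv; rewrite inE vB orbT evG1 //.
  move=> /(_ isT)/eqP; rewrite mulf_eq0 => /orP[|/eqP//].
  by rewrite subr_eq0 => /eqP vE; rewrite -vE vB in aNB.
exists G => [|v Sv]; first by lia.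
by rewrite evG1 // evG // big_cons mulrA.
Qed.

(** * Counting nonzeros on the grid *)

Definition nonzero_on (K : fieldType) (n : nat) (s : seq 'I_n)
    (P : {ffun 'I_n -> K}) (F : {mpoly K[n]}) : pred {ffun 'I_n -> K} :=
  fun Q => [forall j, (j \in s) || (Q j == P j)] && (F.@[Q] != 0).

(** The coordinates in [s] are free, the others frozen at those of [P]. The induction varies [P],
    since each slice that is kept supplies its own nonzero as base point. *)
Lemma count_nonzero_ge (K : fieldType) (n : nat) (A : 'I_n -> {fset K})
    (s : seq 'I_n) (P : {ffun 'I_n -> K}) (F : {mpoly K[n]}) (D : nat) :
    uniq s -> sorted leq [seq #|` A i| | i <- s] ->
    P \in cartesian A -> F.@[P] != 0 -> deg_le D F ->
  (greedy [seq #|` A i| | i <- s] D <=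
    count (nonzero_on s P F) (cartesian A))%N.
Proof.
elim: s P F D => [|i s IH] P F D.
  move=> _ _ PX FP _ /=; rewrite -has_count; apply/hasP; exists P => //.
  by rewrite /nonzero_on FP andbT; apply/forallP => j; rewrite eqxx.
rewrite [uniq _]/= [map _ _]/= [sorted _ _]/=.
move=> /andP[iNs s_uniq] ds_path PX FP degF.
(* [T] and [B] collect the values whose slice of the current subgrid [S] does, respectively does
   not, contain a nonzero of [F]. *)
pose live a := has (nonzero_on s (update P i a) F) (cartesian A).
pose T := [seq a <- A i | live a]; pose B := [seq a <- A i | ~~ live a].
pose S (Q : {ffun 'I_n -> K}) :=
  Q \in cartesian A /\ [forall j, (j \in i :: s) || (Q j == P j)].
have S_live Q : S Q -> F.@[Q] != 0 -> live (Q i).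
  move=> [QX /forallP Qagree] FQ; apply/hasP; exists Q => //.
  rewrite /nonzero_on FQ andbT; apply/forallP => j; rewrite ffunE.
  have := Qagree j; rewrite inE.
  by case: (eqVneq j i) => [->|]; rewrite ?eqxx ?orbT.
have SP : S P by split=> //; apply/forallP => j; rewrite eqxx orbT.
have Ai_P : P i \in A i by move: PX; rewrite in_cartesian => /forallP.
have sz_TB : (size T + size B = #|` A i|)%N.
  by rewrite !size_filter count_predC.
have PT : P i \in T by rewrite mem_filter S_live.
have [||| G sG evG] := @mpoly_div_roots K n i S B F.
- by rewrite filter_uniq ?fset_uniq.
- move=> Q a [QX /forallP Qagree]; rewrite mem_filter => /andP[_ aA]; split.
    rewrite in_cartesian; apply/forallP => j; rewrite ffunE.
    case: eqP => [-> // | _]; by move: QX; rewrite in_cartesian => /forallP.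
  apply/forallP => j; rewrite ffunE; have := Qagree j.
  by rewrite inE; case: (j == i).
- move=> Q SQ; rewrite mem_filter => /andP[Qdead _].
  by apply: contraNeq Qdead => /(S_live _ SQ).
have GP : G.@[P] != 0 by move: FP; rewrite evG // mulf_eq0 => /norP[].
(* As [G] is not the zero polynomial, [msize F - size B] is positive, which forces [size B <= D]. *)
have sG_gt0 : (0 < msize G)%N.
  by rewrite lt0n msize_poly_eq0; apply: contraNneq GP => ->; rewrite meval0.
have T_gt0 : (0 < size T)%N by case: (T) PT.
have D_ge : (size B <= D)%N.
  by have := leq_trans sG_gt0 sG; rewrite subn_gt0 => /leq_trans/(_ degF).
apply: leq_trans (@greedy_cons _ (size B) _ _ ds_path _ D_ge) _.
  by rewrite -sz_TB -subn_gt0 addnK.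
have T_uniq : uniq T by rewrite filter_uniq ?fset_uniq.
(* Group the nonzeros by their coordinate [i] and bound each slice over [T] separately. *)
apply: leq_trans (sum_count_le (fun Q : {ffun 'I_n -> K} => Q i) _ _ T_uniq).
rewrite -sz_TB addnK -sum1_size big_distrl /= big_seq [leqRHS]big_seq.
apply: leq_sum => a aT; rewrite mul1n.
have /hasP[R RX /andP[/forallP Ragree FR]] : live a.
  by move: aT; rewrite mem_filter => /andP[].
have agree_S (Q : {ffun 'I_n -> K}) : Q \in cartesian A ->
    (forall j, (j \in s) || (Q j == R j)) -> S Q /\ Q i = a.
  move=> QX Qagree; have {}Qagree j : (j \in s) || (Q j == update P i a j).
    by have := Qagree j; have := Ragree j; case: (j \in s) => //= /eqP->.
  split; last by have := Qagree i; rewrite (negPf iNs) ffunE eqxx => /eqP.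
  split=> //; apply/forallP => j; have := Qagree j.
  by rewrite inE ffunE; case: (j == i).
have [SR Ri] : S R /\ R i = a by apply: agree_S => // j; rewrite eqxx orbT.
have GR : G.@[R] != 0 by move: FR; rewrite evG // mulf_eq0 => /norP[].
have degG : deg_le (D - size B) G.
  by rewrite /deg_le -subSn // (leq_trans sG) ?leq_sub2r.
apply: leq_trans (IH R G _ s_uniq (path_sorted ds_path) RX GR degG) _.
rewrite -!size_filter; apply: uniq_leq_size.
  by rewrite filter_uniq ?fset_uniq.
move=> Q; rewrite !mem_filter => /andP[/andP[/forallP Qagree GQ] QX].
have [[_ SQ] Qi] := agree_S Q QX Qagree.
rewrite QX andbT Qi eqxx andbT /nonzero_on SQ /= evG // mulf_neq0 //.
(* A live value differs from every dead one, so no factor [Q i - b] vanishes and a nonzero of [G] is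
   one of [F]. *)
rewrite prodf_seq_neq0; apply/allP => b; rewrite mem_filter => /andP[b_dead _].
rewrite Qi subr_eq0; apply: contraNneq b_dead => <-.
by move: aT; rewrite mem_filter => /andP[].
Qed.

(** * Cardinalities and the maximum *)

Local Open Scope fset_scope.
Local Open Scope nat_scope.

Lemma card_cartesian (K : choiceType) (n : nat) (A : 'I_n -> {fset K}) :
  #|` cartesian A| = \prod_(i < n) #|` A i|.
Proof.
rewrite /cartesian card_imfset /= => [|x y /ffunP eq_xy]; last first.
  by apply/ffunP => i; apply: val_inj; have := eq_xy i; rewrite !ffunE.
rewrite -cardE card_dep_ffun foldrE big_map big_enum.
by apply: eq_bigr => i _; rewrite cardfE.
Qed.

Lemma card_zero_set (K : fieldType) (n : nat) (A : 'I_n -> {fset K})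
    (P : {ffun 'I_n -> K}) (F : {mpoly K[n]}) :
  #|` zero_set (cartesian A) F| =
    \prod_(i < n) #|` A i| - count (nonzero_on (enum 'I_n) P F) (cartesian A).
Proof.
rewrite card_fset_sum1 big_fset /= sum1_count -card_cartesian.
rewrite -(count_predC (fun Q : {ffun 'I_n -> K} => F.@[Q] == 0%R)).
rewrite (@eq_count _ (nonzero_on _ _ _)
  (predC (fun Q : {ffun 'I_n -> K} => F.@[Q] == 0%R))).
  by rewrite addnK.
move=> Q; rewrite /nonzero_on /= andb_idl // => _.
by apply/forallP => j; rewrite mem_enum.
Qed.

(** Puts the list of coordinates into the shape that [greedy_cat] evaluates. *)
Lemma enum_ord_split (n : nat) (k : 'I_n) :
  exists s1 s2, [/\ enum 'I_n = s1 ++ k :: s2,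
    all (fun i : 'I_n => i < k) s1 & all (fun i : 'I_n => k < i) s2].
Proof.
have : pairwise (fun i j : 'I_n => i < j) (enum 'I_n).
  rewrite -(pairwise_map val ltn) val_enum_ord.
  by rewrite -(sorted_pairwise ltn_trans) iota_ltn_sorted.
have k_enum : k \in enum 'I_n by rewrite mem_enum.
case/splitPr: k_enum => s1 s2; rewrite pairwise_cat pairwise_cons.
case/and3P => /allrelP lt12 _ /andP[lt2 _]; exists s1, s2; split=> //.
by apply/allP => i /lt12; apply; rewrite mem_head.
Qed.

(** Descend from [N] to the first value attained; excluded middle decides each one, as [S] will be
    an existence statement about polynomials. *)
Lemma bounded_is_max (S : nat -> Prop) (N : nat) :
  (exists j, S j) -> (forall j, S j -> j <= N) -> exists m, is_max S m.
Proof.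
elim: N => [|N IH] [j Sj] le_SN.
  by exists 0; split=> //; have := le_SN j Sj; rewrite leqn0 => /eqP <-.
case: (classic (S N.+1)) => [SN | nSN]; first by exists N.+1.
apply: IH => [|i Si]; first by exists j.
have := le_SN i Si; rewrite leq_eqVlt => /orP[/eqP iN|//].
by case: nSN; rewrite -iN.
Qed.

Theorem corollary3p7 (K : fieldType) (n : nat) (n_ge1 : 1 <= n)
    (A : 'I_n -> {fset K}) (A_nonempty : forall i, A i != fset0)
    (card_mono : forall i j : 'I_n, j = i.+1 :> nat -> #|` A i| <= #|` A j|)
    (d : nat) (d_ge1 : 1 <= d)
    (k : 'I_n) (l : nat) (l_bounds : 1 <= l <= #|` A k| - 1)
    (d_eq : d = \sum_(i < n | i < k) (#|` A i| - 1) + l) :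
  exists2 m : nat, is_max (zero_count (cartesian A) d) m &
    m <= \prod_(i < n | k < i) #|` A i| *
         (\prod_(i < n | i <= k) #|` A i| - #|` A k| + l).
Proof.
set N := _ * _; have card_gt0 i : 0 < #|` A i| by rewrite cardfs_gt0.
have card_sorted : sorted leq [seq #|` A i| | i <- enum 'I_n].
  apply/(sortedP 0) => i; rewrite size_map size_enum_ord => lt_i1n.
  have lt_in := ltnW lt_i1n; pose i0 := Ordinal lt_in.
  rewrite !(@nth_map _ i0 _ 0 _ _ (enum 'I_n)) ?size_enum_ord //.
  by apply: card_mono; rewrite !nth_enum_ord.
have [s1 [s2 [enumE lt_s1 lt_s2]]] := enum_ord_split k.
have filter_s1 : [seq i : 'I_n <- s1 ++ k :: s2 | i < k] = s1.
  rewrite filter_cat /= ltnn (@eq_in_filter _ _ pred0 s2).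
    by rewrite filter_pred0 cats0; apply/all_filterP.
  by move=> i /(allP lt_s2) /=; lia.
have filter_s2 : [seq i : 'I_n <- s1 ++ k :: s2 | k < i] = s2.
  rewrite filter_cat /= ltnn (@eq_in_filter _ _ pred0 s1).
    by rewrite filter_pred0 /=; apply/all_filterP.
  by move=> i /(allP lt_s1) /=; lia.
have sumE : \sum_(i < n | i < k) (#|` A i| - 1) = \sum_(i <- s1) (#|` A i| - 1).
  by rewrite -[in RHS]filter_s1 -enumE big_filter big_enum_cond.
have prodE : \prod_(i < n | k < i) #|` A i| = \prod_(i <- s2) #|` A i|.
  by rewrite -[in RHS]filter_s2 -enumE big_filter big_enum_cond.
have greedyE : greedy [seq #|` A i| | i <- enum 'I_n] d =
    (#|` A k| - l) * \prod_(i < n | k < i) #|` A i|.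
  rewrite d_eq sumE prodE enumE map_cat /=.
  rewrite -(big_map (fun i => #|` A i|) xpredT (fun e => e - 1)).
  rewrite greedy_cat ?big_map //; last first.
    by rewrite -(ltn_predK (card_gt0 k)) ltnS -subn1.
  by apply/allP => _ /mapP[i _ ->].
have boundE : \prod_(i < n) #|` A i| -
    greedy [seq #|` A i| | i <- enum 'I_n] d = N.
  rewrite greedyE /N; set u := \prod_(i < n | k < i) _.
  have -> : \prod_(i < n) #|` A i| = u * \prod_(i < n | i <= k) #|` A i|.
    rewrite (bigID (fun i : 'I_n => k < i)) /=; congr (_ * _).
    by apply: eq_bigl => i; rewrite -leqNgt.
  (* Guards the truncated subtraction when [v - (d_k - l)] is rewritten as [v - d_k + l]. *)
  have : #|` A k| <= \prod_(i < n | i <= k) #|` A i|.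
    by rewrite (bigD1 k) //= leq_pmulr // prodn_gt0.
  move: (\prod_(i < n | i <= k) _) => v le_kv.
  by rewrite (mulnC _ u) -mulnBr; congr (_ * _); lia.
have le_N j : zero_count (cartesian A) d j -> j <= N.
  case=> F [degF [P PX FP] <-]; rewrite (card_zero_set _ P) -boundE leq_sub2l //.
  by apply: count_nonzero_ge; rewrite ?enum_uniq.
have [m m_max] : exists m, is_max (zero_count (cartesian A) d) m.
  apply: bounded_is_max le_N.
  (* The constant 1 shows that some count is attained, the grid being non-empty. *)
  exists #|` zero_set (cartesian A) (1 : {mpoly K[n]})%R|, 1%R; split=> //.
    by rewrite /deg_le msize1.
  pose P := [ffun i => xchoose (fset0Pn _ (A_nonempty i))].
  exists P; last by rewrite meval1 GRing.oner_neq0.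
  rewrite in_cartesian; apply/forallP => i.
  by rewrite ffunE (xchooseP (fset0Pn _ (A_nonempty i))).
by exists m => //; apply: le_N; case: m_max.
Qed.
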